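(* For $\mathcal S=\{(0,1),(1,-1),(-1,-1),(-2,1)\}$, the generating function of quadrant walks with steps in $\mathcal S$ is $$Q(x,y)=[x^{\ge}y^{\ge}]\frac{(x^3-2y^2-x)(y^2-x)(x^2y^2-y^2-2x)}{x^5y^4\left(1-t(y+x\bar y+\bar x\bar y+\bar x^2y)\right)},$$ where the right-hand side is seen as a power series in $t$ with coefficients in $\mathbb Q[x,\bar x,y,\bar y]$. The coefficients are hypergeometric: $q(i,j;n)$ is zero unless $n$ is of the form $n=2i+j+4m$ (with $m\in\mathbb N$), in which case $$q(i,j;n)=\frac{(i+1)(j+1)(i+j+2)\,n!\,(n+2)!}{m!\,(3m+2i+j+2)!\,(2m+i+1)!\,(2m+i+j+2)!}.$$ The excursion exponent $\alpha_e$ and the walk exponent $\alpha_w$ are both $-4$.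
   Context: $\bar x=1/x$, $\bar y=1/y$, $\mathbb N=\{0,1,2,\ldots\}$. $Q(x,y)\equiv Q(x,y;t)=\sum_{i,j,n\ge0}q(i,j;n)x^iy^jt^n$, where $q(i,j;n)$ is the number of $n$-step walks with steps in $\mathcal S$ from $(0,0)$ to $(i,j)$ staying in $\mathbb N^2$. $[x^\ge y^\ge]$ keeps only the monomials $x^iy^jt^n$ with $i,j\ge0$. The excursion exponent $\alpha_e$ is the exponent of $n$ in the asymptotic behaviour of the number of quadrant excursions: with $p$ the period of the model (the gcd of the lengths of walks with steps in $\mathcal S$, not confined to the quadrant, from the origin to itself), there are $\mu>0$ and constants $\kappa_1,\kappa_2>0$ with $\kappa_1\mu^nn^{\alpha_e}\le q(0,0;n)\le\kappa_2\mu^nn^{\alpha_e}$ for all large $n$ divisible by $p$. The walk exponent $\alpha_w$ is the exponent of $n$ in the asymptotic behaviour of the total number $q_n=\sum_{i,j}q(i,j;n)$ of $n$-step quadrant walks: $q_n\sim C_n\rho^nn^{\alpha_w}$ for some $\rho>0$ and some positive sequence $C_n$ that is periodic in $n$. *)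

(* Defs.v *)
From HB Require Import structures.
From mathcomp Require Import all_boot all_order all_algebra finmap.
From mathcomp Require Import all_classical all_reals all_analysis.

Set Implicit Arguments.
Unset Strict Implicit.
Unset Printing Implicit Defensive.

Import Order.TTheory GRing.Theory Num.Theory.
Import numFieldNormedType.Exports.
Local Open Scope classical_set_scope.
Local Open Scope fset_scope.
Local Open Scope ring_scope.

Notation step := (int * int)%type.

(* Laurent polynomials in x and y: the exponent (i, j) : int * int stands for
   the monomial x^i y^j.  The monoid algebras of multinomials do not apply, as
   they require a monoid without invertible elements. *)
Section Laurent.
Variable R : comNzRingType.
Local Notation L0 := {fsfun step -> R with 0}.

Definition laurent := L0.
HB.instance Definition _ := Choice.on laurent.

Definition lcoef (f : laurent) (k : step) : R := (f : L0) k.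
Definition lsupp (f : laurent) : {fset step} := finsupp (f : L0).

Lemma laurentP (f g : laurent) : lcoef f =1 lcoef g -> f = g.
Proof. by move=> fg; apply/fsfunP. Qed.

Lemma lcoef_out (f : laurent) k : k \notin lsupp f -> lcoef f k = 0.
Proof. exact: fsfun_dflt. Qed.

Definition mklaurent (D : {fset step}) (E : step -> R) : laurent :=
  [fsfun k in D => E k].

Lemma lcoef_mk D E k : lcoef (mklaurent D E) k = if k \in D then E k else 0.
Proof. by rewrite /lcoef /mklaurent fsfun_fun. Qed.

Definition lzero := mklaurent fset0 (fun=> 0).
Definition lopp f := mklaurent (lsupp f) (fun k => - lcoef f k).
Definition ladd f g :=
  mklaurent (lsupp f `|` lsupp g) (fun k => lcoef f k + lcoef g k).

Lemma lcoef_zero k : lcoef lzero k = 0.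
Proof. by rewrite lcoef_mk in_fset0. Qed.

Lemma lcoef_opp f k : lcoef (lopp f) k = - lcoef f k.
Proof. by rewrite lcoef_mk; case: ifPn => // /lcoef_out ->; rewrite oppr0. Qed.

Lemma lcoef_add f g k : lcoef (ladd f g) k = lcoef f k + lcoef g k.
Proof.
rewrite lcoef_mk in_fsetU; case: ifPn => //.
by rewrite negb_or => /andP[/lcoef_out -> /lcoef_out ->]; rewrite addr0.
Qed.

Fact laddA : associative ladd.
Proof. by move=> f g h; apply/laurentP => k; rewrite !lcoef_add addrA. Qed.
Fact laddC : commutative ladd.
Proof. by move=> f g; apply/laurentP => k; rewrite !lcoef_add addrC. Qed.
Fact ladd0 : left_id lzero ladd.
Proof. by move=> f; apply/laurentP => k; rewrite lcoef_add lcoef_zero add0r. Qed.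
Fact laddN : left_inverse lzero lopp ladd.
Proof.
by move=> f; apply/laurentP => k; rewrite lcoef_add lcoef_opp lcoef_zero addNr.
Qed.

HB.instance Definition _ := GRing.isZmodule.Build laurent laddA laddC ladd0 laddN.

Lemma lcoef0 k : lcoef 0 k = 0. Proof. exact: lcoef_zero. Qed.
Lemma lcoefD f g k : lcoef (f + g) k = lcoef f k + lcoef g k.
Proof. exact: lcoef_add. Qed.
Lemma lcoef_sum I (r : seq I) P (F : I -> laurent) k :
  lcoef (\sum_(i <- r | P i) F i) k = \sum_(i <- r | P i) lcoef (F i) k.
Proof.
by apply: (big_morph (lcoef^~ k)) => [f g|]; rewrite ?lcoefD ?lcoef0.
Qed.

(* c x^i y^j with k = (i, j). *)
Definition lmon (c : R) (k : step) : laurent := mklaurent [fset k] (fun=> c).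

Lemma lcoef_mon c k l : lcoef (lmon c k) l = if l == k then c else 0.
Proof. by rewrite lcoef_mk in_fset1. Qed.

Lemma laurentE f : f = \sum_(k <- lsupp f) lmon (lcoef f k) k.
Proof.
apply/laurentP => l; rewrite lcoef_sum.
under eq_bigr do rewrite lcoef_mon.
have [lf|lf] := boolP (l \in lsupp f); last first.
  rewrite lcoef_out// big_seq big1// => k kf; case: eqP => // lk.
  by rewrite -lk (negPf lf) in kf.
rewrite (big_fsetD1 l)//= eqxx big_seq big1 ?addr0// => k.
by rewrite in_fsetD1 eq_sym => /andP[/negPf ->].
Qed.

Lemma laurent_ind (P : laurent -> Prop) :
  P 0 -> (forall f g, P f -> P g -> P (f + g)) -> (forall c k, P (lmon c k)) ->
  forall f, P f.
Proof. by move=> P0 PD PM f; rewrite (laurentE f); apply: big_ind. Qed.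

Definition lmul (f g : laurent) : laurent :=
  mklaurent [fset k + l | k in lsupp f, l in lsupp g]
    (fun m => \sum_(k <- lsupp f) lcoef f k * lcoef g (m - k)).

Lemma lcoef_mul f g m :
  lcoef (lmul f g) m = \sum_(k <- lsupp f) lcoef f k * lcoef g (m - k).
Proof.
rewrite lcoef_mk; case: ifPn => // mN; rewrite big_seq big1// => k kf.
rewrite [lcoef g _]lcoef_out ?mulr0//; apply: contra mN => mkg.
by apply/imfset2P; exists k => //; exists (m - k) => //; rewrite addrC subrK.
Qed.

Lemma lcoef_mulw (D : {fset step}) f g m : lsupp f `<=` D ->
  lcoef (lmul f g) m = \sum_(k <- D) lcoef f k * lcoef g (m - k).
Proof.
move=> fD; rewrite lcoef_mul; apply: (big_fset_incl _ fD) => k _ kf.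
by rewrite lcoef_out// mul0r.
Qed.

Fact lmulDl : left_distributive lmul +%R.
Proof.
move=> f g h; apply/laurentP => m; rewrite lcoefD.
pose D := lsupp (f + g) `|` (lsupp f `|` lsupp g).
rewrite !(@lcoef_mulw D) -?big_split /=; last 3 first.
- by apply: fsubset_trans (fsubsetUr _ _); exact: fsubsetUr.
- by apply: fsubset_trans (fsubsetUr _ _); exact: fsubsetUl.
- exact: fsubsetUl.
by apply: eq_bigr => k _; rewrite lcoefD mulrDl.
Qed.

Fact lmulDr : right_distributive lmul +%R.
Proof.
move=> f g h; apply/laurentP => m; rewrite lcoefD !lcoef_mul -big_split /=.
by apply: eq_bigr => k _; rewrite lcoefD mulrDr.
Qed.

Fact lmul0 : left_zero 0 lmul.
Proof.
move=> f; apply/laurentP => m; rewrite lcoef_mul lcoef0 big1// => k _.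
by rewrite lcoef0 mul0r.
Qed.

Fact lmulr0 : right_zero 0 lmul.
Proof.
move=> f; apply/laurentP => m; rewrite lcoef_mul lcoef0 big1// => k _.
by rewrite lcoef0 mulr0.
Qed.

Lemma lsupp_mon c k : lsupp (lmon c k) `<=` [fset k].
Proof.
apply/fsubsetP => l; rewrite in_fset1 mem_finsupp -/(lcoef _ _) lcoef_mon.
by case: (l == k); rewrite // eqxx.
Qed.

Lemma lmon_mul c d k l : lmul (lmon c k) (lmon d l) = lmon (c * d) (k + l).
Proof.
apply/laurentP => m; rewrite (lcoef_mulw _ _ (lsupp_mon c k)) big_seq_fset1.
rewrite !lcoef_mon eqxx subr_eq [l + k]addrC.
by case: (m == k + l); rewrite ?mulr0.
Qed.

Fact lmulC : commutative lmul.
Proof.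
elim/laurent_ind => [|f1 f2 IH1 IH2|c k] g.
- by rewrite lmul0 lmulr0.
- by rewrite lmulDl lmulDr IH1 IH2.
elim/laurent_ind: g => [|g1 g2 IH1 IH2|d l].
- by rewrite lmul0 lmulr0.
- by rewrite lmulDl lmulDr IH1 IH2.
by rewrite !lmon_mul mulrC addrC.
Qed.

Fact lmulA : associative lmul.
Proof.
elim/laurent_ind => [|f1 f2 IH1 IH2|c k] g h; first by rewrite !lmul0.
  by rewrite !lmulDl IH1 IH2.
elim/laurent_ind: g => [|g1 g2 IH1 IH2|d l].
- by rewrite !(lmul0, lmulr0).
- by rewrite !(lmulDl, lmulDr) IH1 IH2.
elim/laurent_ind: h => [|h1 h2 IH1 IH2|e m]; first by rewrite !lmulr0.
  by rewrite !lmulDr IH1 IH2.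
by rewrite !lmon_mul mulrA addrA.
Qed.

Fact lmul1 : left_id (lmon 1 0) lmul.
Proof.
elim/laurent_ind => [|f g IHf IHg|c k]; first by rewrite lmulr0.
  by rewrite lmulDr IHf IHg.
by rewrite lmon_mul mul1r add0r.
Qed.

Fact lone_neq0 : lmon 1 0 != 0.
Proof.
apply/eqP => /(congr1 (lcoef^~ 0)); rewrite lcoef_mon eqxx lcoef0.
by apply/eqP; exact: oner_neq0.
Qed.

HB.instance Definition _ := GRing.Zmodule_isComNzRing.Build laurent
  lmulA lmulC lmul1 lmulDl lone_neq0.

End Laurent.

(* Formal power series in t over A, given by their sequence of coefficients. *)
Section PowerSeries.
Variable A : comNzRingType.

Definition fps := nat -> A.
HB.instance Definition _ := GRing.Zmodule.copy fps (nat -> A).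

Definition fps_const (a : A) : fps := fun n => if n == 0%N then a else 0.
Definition fps_t : fps := fun n => (n == 1%N)%:R.
Definition fps_mul (f g : fps) : fps :=
  fun n => \sum_(i < n.+1) f i * g (n - i)%N.

Let tr N (f : fps) : {poly A} := \poly_(i < N.+1) f i.

Let fps_mul_tr N f g n : (n <= N)%N -> fps_mul f g n = (tr N f * tr N g)`_n.
Proof.
move=> nN; rewrite coefM; apply: eq_bigr => i _.
have iN : (i < N.+1)%N by rewrite ltnS (leq_trans _ nN)// -ltnS.
by rewrite !coef_poly iN ltnS (leq_trans (leq_subr _ _) nN).
Qed.

Fact fps_mulC : commutative fps_mul.
Proof.
by move=> f g; apply/funext => n; rewrite !(@fps_mul_tr n)// mulrC.
Qed.

Fact fps_mulA : associative fps_mul.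
Proof.
move=> f g h; apply/funext => n.
transitivity ((tr n f * (tr n g * tr n h))`_n).
  rewrite coefM; apply: eq_bigr => i _; rewrite coef_poly ltn_ord.
  by congr (_ * _); apply: fps_mul_tr; exact: leq_subr.
rewrite mulrA coefM; apply: eq_bigr => i _.
rewrite coef_poly ltnS leq_subr; congr (_ * _).
by apply/esym/fps_mul_tr; rewrite -ltnS.
Qed.

Fact fps_mul1 : left_id (fps_const 1) fps_mul.
Proof.
move=> f; apply/funext => n; rewrite /fps_mul big_ord_recl /= subn0 mul1r.
by rewrite big1 ?addr0// => i _; rewrite mul0r.
Qed.

Fact fps_mulDl : left_distributive fps_mul +%R.
Proof.
move=> f g h; apply/funext => n; rewrite -[RHS]big_split /=.
by apply: eq_bigr => i _; rewrite -mulrDl.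
Qed.

Fact fps_one_neq0 : fps_const 1 != 0.
Proof.
apply/eqP => /(congr1 (fun f : fps => f 0%N)); apply/eqP; exact: oner_neq0.
Qed.

HB.instance Definition _ := GRing.Zmodule_isComNzRing.Build fps
  fps_mulA fps_mulC fps_mul1 fps_mulDl fps_one_neq0.

(* Following the library's convention, the inverse of a non-unit is itself. *)
Definition fps_unit : {pred fps} := [pred f | `[< exists g : fps, g * f = 1 >]].
Definition fps_inv (f : fps) : fps :=
  if pselect (exists g : fps, g * f = 1) is left fU then projT1 (cid fU) else f.

Fact fps_mulV : {in fps_unit, left_inverse 1 fps_inv *%R}.
Proof.
move=> f /asboolP fU; rewrite /fps_inv; case: pselect => // fU'.
by case: (cid fU').
Qed.

Fact fps_unitP (f g : fps) : g * f = 1 -> fps_unit f.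
Proof. by move=> gf; apply/asboolP; exists g. Qed.

Fact fps_inv_out : {in [predC fps_unit], fps_inv =1 id}.
Proof.
move=> f /negP fU; rewrite /fps_inv; case: pselect => // fU'.
by case: fU; apply/asboolP.
Qed.

HB.instance Definition _ := GRing.ComNzRing_hasMulInverse.Build fps
  fps_mulV fps_unitP fps_inv_out.

End PowerSeries.

Definition in_quadrant (k : step) : bool := (0 <= k.1) && (0 <= k.2).

(* The operator [x^>= y^>=], applied coefficientwise in t. *)
Definition nonneg_part (F : fps (laurent rat)) : fps (laurent rat) :=
  fun n => mklaurent (lsupp (F n))
    (fun k => if in_quadrant k then lcoef (F n) k else 0).

Section Walks.
Variable S : {fset step}.

Definition position (w : seq S) : step := \sum_(s <- w) val s.

Definition stays_in_quadrant n (w : n.-tuple S) : bool :=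
  [forall k : 'I_n.+1, in_quadrant (position (take k w))].

Definition quadrant_walks (i j n : nat) : nat :=
  #|[set w : n.-tuple S | stays_in_quadrant w
                          & position w == (i%:Z, j%:Z)]|.

(* The finitely supported sums over all (i, j) are genuine finite sums, since
   there are finitely many walks of length n. *)
Definition walk_gf : fps (laurent rat) :=
  fun n => \sum_(ij \in [set: nat * nat])
    lmon ((quadrant_walks ij.1 ij.2 n)%:R : rat) (ij.1%:Z, ij.2%:Z).

Definition total_quadrant_walks (n : nat) : nat :=
  (\big[addn/0]_(ij \in [set: nat * nat]) quadrant_walks ij.1 ij.2 n)%N.

Definition closed_walk_length (n : nat) : Prop :=
  exists w : n.-tuple S, position w = 0.

(* p is the gcd of the (in general infinite) set of lengths of closed walks. *)
Definition is_period (p : nat) : Prop :=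
  forall d : nat, (d %| p)%N <-> (forall n, closed_walk_length n -> (d %| n)%N).

Definition excursion_exponent (R : realType) (alpha : R) : Prop :=
  exists p : nat, is_period p /\
  exists mu k1 k2 : R, [/\ 0 < mu, 0 < k1, 0 < k2 &
    \forall n \near \oo, (p %| n)%N ->
      k1 * mu ^+ n * n%:R `^ alpha <= (quadrant_walks 0 0 n)%:R
        <= k2 * mu ^+ n * n%:R `^ alpha].

Definition walk_exponent (R : realType) (alpha : R) : Prop :=
  exists (rho : R) (C : nat -> R),
    [/\ 0 < rho, forall n, 0 < C n,
        exists2 p : nat, (0 < p)%N & forall n, C (n + p)%N = C n &
        (fun n => (total_quadrant_walks n)%:R / (C n * rho ^+ n * n%:R `^ alpha))
          @ \oo --> (1 : R)].

End Walks.

(* Main.v *)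
Require Import Defs.
From HB Require Import structures.
From mathcomp Require Import all_boot all_order all_algebra finmap.
From mathcomp Require Import all_classical all_reals all_analysis.
From mathcomp Require Import ring lra zify.

(** The step polynomial factors as S = (y + x/y)(1 + x^-2), so the number of
    unconfined n-step walks ending at (k - 2l, n - 2k) is the product of
    binomials C(n, k) C(n, l): k counts the choices of x/y in the first factor
    and l the choices of x^-2 in the second.  Multiplying S^n by the eight
    monomials of the numerator divided by x^5 y^4 gives a combination of eight
    such products, which collapses to a single hypergeometric term
    ([kernel_coefE]) with the factor (i + 1)(j + 1)(i + j + 2), where (i, j) is
    the exponent.  Written with reciprocal factorials that vanish at negative
    integers, the identity holds for all integers k and l, on and beyond the
    boundary.

    This identity contains the whole enumeration.  The coefficients of the
    rational series satisfy the step-by-step recursion of unconfined walks.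
    Since no step increases a coordinate by more than one, the recursion at a
    point of the quadrant only reads points with coordinates at least -1, and
    the factor (i + 1)(j + 1) makes the coefficients vanish on the lines i = -1
    and j = -1.  So they obey the recursion of quadrant walks too, with the same
    initial values ([walks_to_kernel]); the formula for q(i, j; n) is the same
    term read at natural i and j, with m = l.

    For the exponents, write n = 4M + r with r < 4.  The endpoints reached by
    n-step walks lie on the lines 2i + j = r + 4d with d <= M, and then
    m = M - d.  Every factorial in q(i, j; n) is (cM + offset)! with c in
    {1, 2, 3, 4}, so for fixed r, i and d the quotient q(i, j; n) M^3 / b(M) has
    a positive limit, where b(M) = C(4M, M) C(4M, 2M) ([term_cvg]).  The walk
    number is also (i + 1)(j + 1)(i + j + 2) times
    C(n+2, m) C(n+3, 2m+i+1) / ((n+1)(n+2)(n+3)), and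
    lowering m below n/4 costs a factor at least 3 each time in C(n+2, m), while
    the other binomial is bounded by the central one.  Hence the line of index d
    contributes at most a constant times (d + 1)^4 3^-d b(M) / M^3
    ([layer_le]), and
    dominated convergence lets the limit pass to the sum over all endpoints
    ([total_cvg]).  Finally M b(M) / (4096/27)^M increases, (M + 1) b(M) /
    (4096/27)^M decreases, so the former has a positive limit
    ([main_bin_asymptotics]) without recourse to Stirling's formula.  With
    rho^4 = 4096/27, the total number of walks divided by rho^n n^-4 therefore
    has a positive limit along each class of n modulo 4, and so does q(0, 0; n)
    along the multiples of 4, which is the period. *)

Set Implicit Arguments.
Unset Strict Implicit.
Unset Printing Implicit Defensive.

Import Order.TTheory GRing.Theory Num.Theory.
Import numFieldNormedType.Exports.
Local Open Scope ring_scope.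

(** * Reciprocal factorials and binomial coefficients with integer index *)

(** The function 1/Gamma(z + 1) on the integers: with the value 0 at negative
    integers, z / z! = 1 / (z - 1)! holds everywhere, so the identities below
    have no boundary cases. *)
Definition invfact (z : int) : rat := if z is Posz n then (n`!%:R)^-1 else 0.

Lemma invfact_pred z : invfact (z - 1) = z%:~R * invfact z.
Proof.
case: z => [[|n]|n]; first by rewrite mul0r.
  have -> : n.+1%:Z - 1 = n%:Z by lia.
  by rewrite /= factS natrM invfM mulrA mulfV ?mul1r// pnatr_eq0.
have -> : Negz n - 1 = Negz n.+1 by lia.
by rewrite mulr0.
Qed.

Definition binz (n : nat) (k : int) : rat :=
  n`!%:R * invfact k * invfact (n%:Z - k).

Lemma binz0 k : binz 0 k = (k == 0)%:R.
Proof. by case: k => [[|n]|n]; rewrite /binz /= ?mulr0 ?mul0r// invr1 !mulr1. Qed.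

Lemma binzS n k : binz n.+1 k = binz n k + binz n (k - 1).
Proof.
rewrite /binz !(invfact_pred k).
have -> : n%:Z - (k - 1) = n.+1%:Z - k by lia.
have -> : n%:Z - k = n.+1%:Z - k - 1 by lia.
rewrite invfact_pred factS natrM rmorphB /= -[n.+1%:~R]/(n.+1%:R).
ring.
Qed.

(** * Coefficients of Laurent polynomials *)

Section LaurentLemmas.
Variable R : comNzRingType.
Implicit Types (f : laurent R) (k l : step).

Lemma lcoef_lmonM c k f l : lcoef (lmon c k * f) l = c * lcoef f (l - k).
Proof.
rewrite -[lmon c k * f]/(lmul _ _) (lcoef_mulw _ _ (lsupp_mon c k)).
by rewrite big_seq_fset1 lcoef_mon eqxx.
Qed.

Lemma lmonM c d k l : lmon c k * lmon d l = lmon (c * d) (k + l) :> laurent R.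
Proof. exact: lmon_mul. Qed.

Lemma lcoef1 k : lcoef (1 : laurent R) k = (k == 0)%:R.
Proof. by rewrite -[1]/(lmon 1 0) lcoef_mon; case: (k == 0). Qed.

Lemma lcoefN f k : lcoef (- f) k = - lcoef f k.
Proof. exact: lcoef_opp. Qed.

Lemma natr_lmon n : n%:R = lmon n%:R 0 :> laurent R.
Proof.
apply/laurentP => k; rewrite lcoef_mon.
elim: n => [|n IHn]; first by rewrite lcoef0; case: ifP.
by rewrite -!natr1 lcoefD IHn lcoef1; case: (k == 0); rewrite ?addr0.
Qed.

End LaurentLemmas.

(** * Unconfined walks and the closed form *)

Definition step_gf : laurent rat :=
  lmon 1 (0, 1) + lmon 1 (1, -1) + lmon 1 (-1, -1) + lmon 1 (-2, 1).

Lemma lcoef_step_gfM f (i j : int) :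
  lcoef (step_gf * f) (i, j) =
  lcoef f (i, j - 1) + lcoef f (i - 1, j + 1)
  + lcoef f (i + 1, j + 1) + lcoef f (i + 2, j - 1).
Proof.
rewrite !mulrDl !lcoefD !lcoef_lmonM !mul1r.
by do !congr (_ + _); congr (lcoef f (_, _)) => /=; lia.
Qed.

(** S = (y + x/y)(1 + x^-2): the power S^n is a product of two binomial
    expansions, here proved through Pascal's rule in each index. *)
Lemma lcoef_step_gfX n (k l : int) :
  lcoef (step_gf ^+ n) (k - 2 * l, n%:Z - 2 * k) = binz n k * binz n l.
Proof.
elim: n k l => [|n IHn] k l.
  rewrite expr0 lcoef1 !binz0 -natrM mulnb; congr (_%:R).
  by congr nat_of_bool; apply/eqP/andP => [[]|[/eqP -> /eqP ->]//]; lia.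
rewrite exprS lcoef_step_gfM !binzS.
have -> : (k - 2 * l, n.+1%:Z - 2 * k - 1) = (k - 2 * l, n%:Z - 2 * k)
  by congr pair; lia.
have -> : (k - 2 * l - 1, n.+1%:Z - 2 * k + 1) = (k - 1 - 2 * l, n%:Z - 2 * (k - 1))
  by congr pair; lia.
have -> : (k - 2 * l + 1, n.+1%:Z - 2 * k + 1) = (k - 1 - 2 * (l - 1), n%:Z - 2 * (k - 1))
  by congr pair; lia.
have -> : (k - 2 * l + 2, n.+1%:Z - 2 * k - 1) = (k - 2 * (l - 1), n%:Z - 2 * k)
  by congr pair; lia.
rewrite !IHn; ring.
Qed.

Lemma lcoef_step_gfX_out n (i j : int) :
  (forall k l : int, i = k - 2 * l -> j = n%:Z - 2 * k -> False) ->
  lcoef (step_gf ^+ n) (i, j) = 0.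
Proof.
elim: n i j => [|n IHn] i j out.
  rewrite expr0 lcoef1; case: eqP => // -[i0 j0].
  by case: (out 0 0); rewrite ?i0 ?j0.
rewrite exprS lcoef_step_gfM !IHn ?addr0// => k l ik jk.
- by apply: (out k (l + 1)); lia.
- by apply: (out (k + 1) (l + 1)); lia.
- by apply: (out (k + 1) l); lia.
- by apply: (out k l); lia.
Qed.

Definition numerator : laurent rat :=
  let x := lmon 1 (1, 0) in let y := lmon 1 (0, 1) in
  (x ^+ 3 - 2 * y ^+ 2 - x) * (y ^+ 2 - x) * (x ^+ 2 * y ^+ 2 - y ^+ 2 - 2 * x).

(** The coefficient of t^n in the rational series of the theorem. *)
Definition kernel_coef (n : nat) : laurent rat :=
  numerator * lmon 1 (-5, -4) * step_gf ^+ n.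

Lemma lmon_xy (a b : nat) :
  lmon 1 (1, 0) ^+ a * lmon 1 (0, 1) ^+ b = lmon 1 (a%:Z, b%:Z) :> laurent rat.
Proof.
have xX : lmon 1 (1, 0) ^+ a = lmon 1 (a%:Z, 0) :> laurent rat.
  elim: a => [|a IHa]; first by [].
  by rewrite exprS IHa lmonM mulr1; congr (lmon _ (_, _)); lia.
have yX : lmon 1 (0, 1) ^+ b = lmon 1 (0, b%:Z) :> laurent rat.
  elim: b => [|b IHb]; first by [].
  by rewrite exprS IHb lmonM mulr1; congr (lmon _ (_, _)); lia.
by rewrite xX yX lmonM mulr1; congr (lmon _ (_, _)); rewrite /= ?addr0 ?add0r.
Qed.

(** With p = x/y^2 and z = x^-2, the quotient by x^5 y^4 is
    (1 - p)((1 - z)^2 + 4z^2 - 2z(1 - z)(p + 1/p)); multiplying by p^a z^b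
    shifts (k, l) to (k - a, l - b) in the coordinates of [lcoef_step_gfX]. *)
Lemma numeratorE : numerator * lmon 1 (-5, -4) =
  lmon 1 (0, 0) - lmon 1 (1, -2) + lmon 3 (-4, 0) - lmon 3 (-3, -2)
  - lmon 2 (-3, 2) + lmon 2 (-5, 2) + lmon 2 (0, -4) - lmon 2 (-2, -4).
Proof.
rewrite /numerator.
set x := lmon 1 (1, 0); set y := lmon 1 (0, 1).
transitivity ((x ^+ 5 * y ^+ 4 - x ^+ 6 * y ^+ 2
    + 3 * (x ^+ 1 * y ^+ 4) - 3 * (x ^+ 2 * y ^+ 2)
    - 2 * (x ^+ 2 * y ^+ 6) + 2 * (x ^+ 0 * y ^+ 6)
    + 2 * (x ^+ 5 * y ^+ 0) - 2 * (x ^+ 3 * y ^+ 0)) * lmon 1 (-5, -4)).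
  congr (_ * _); ring.
rewrite !lmon_xy !(natr_lmon _ 2) !(natr_lmon _ 3) !mulrDl !mulNr !lmonM.
by do !congr (_ + _); rewrite ?mulr1.
Qed.

(** The hypergeometric term at i = k - 2l and j = n - 2k; the first three
    factors are i + 1, j + 1 and i + j + 2, and l plays the part of m. *)
Definition closed_form n (k l : int) : rat :=
  (k - 2 * l + 1)%:~R * (n%:Z - 2 * k + 1)%:~R * (n%:Z - k - 2 * l + 2)%:~R
  * n`!%:R * (n.+2)`!%:R * invfact l * invfact (n%:Z - l + 2)
  * invfact (k + 1) * invfact (n%:Z - k + 2).

(** The eight products of binomials of [kernel_coefE], once the reciprocal
    factorials are all expressed by K = 1/(k+1)!, K' = 1/(n-k+2)!, L = 1/l! and
    L' = 1/(n-l+2)!, with f = n!. *)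
Lemma kernel_identity (F : comNzRingType) (n k l f K K' L L' : F) :
 1 *
  (f * ((k + 1) * K) * ((n - (k - 1)) * ((n - k + 2) * K')) *
   (f * L * ((n - (l - 1)) * ((n - l + 2) * L')))) -
  1 *
  (f * (k * ((k + 1) * K)) * ((n - k + 2) * K') *
   (f * L * ((n - (l - 1)) * ((n - l + 2) * L')))) +
  3 *
  (f * ((k + 1) * K) * ((n - (k - 1)) * ((n - k + 2) * K')) *
   (f * ((l - 1) * (l * L)) * L')) -
  3 *
  (f * (k * ((k + 1) * K)) * ((n - k + 2) * K') *
   (f * ((l - 1) * (l * L)) * L')) -
  2 *
  (f * K * ((n - k) * ((n - (k - 1)) * ((n - k + 2) * K'))) *
   (f * (l * L) * ((n - l + 2) * L'))) +
  2 *
  (f * K * ((n - k) * ((n - (k - 1)) * ((n - k + 2) * K'))) *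
   (f * ((l - 1) * (l * L)) * L')) +
  2 *
  (f * ((k - 1) * (k * ((k + 1) * K))) * K' *
   (f * (l * L) * ((n - l + 2) * L'))) -
  2 *
  (f * ((k - 1) * (k * ((k + 1) * K))) * K' *
   (f * ((l - 1) * (l * L)) * L')) =
  (k - 2 * l + 1) * (n - 2 * k + 1) * (n - k - 2 * l + 2) *
  f * ((n + 1 + 1) * ((n + 1) * f)) * L * L' * K * K'.
Proof. ring. Qed.

Lemma kernel_coefE n (k l : int) :
  lcoef (kernel_coef n) (k - 2 * l, n%:Z - 2 * k) = closed_form n k l.
Proof.
rewrite /kernel_coef numeratorE; set ij := (k - _, _).
rewrite !(mulrDl, mulNr) !(lcoefD, lcoefN) {}/ij.
have E (a b : int) c p q : p = a - 2 * b -> q = - (2 * a) ->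
    lcoef (lmon c (p, q) * step_gf ^+ n) (k - 2 * l, n%:Z - 2 * k) =
    c * (binz n (k - a) * binz n (l - b)).
  move=> -> ->; rewrite lcoef_lmonM -lcoef_step_gfX.
  by congr (_ * lcoef _ _); congr pair => /=; lia.
rewrite (E 0 0)// (E 1 0)// (E 0 2)// (E 1 2)// (E (-1) 1)// (E (-1) 2)//.
rewrite (E 2 1)// (E 2 2)// {E} /closed_form /binz.
pose K := invfact (k + 1); pose K' := invfact (n%:Z - k + 2).
pose L := invfact l; pose L' := invfact (n%:Z - l + 2).
have down z z' : z' = z - 1 -> invfact z' = z%:~R * invfact z.
  by move=> ->; exact: invfact_pred.
rewrite -/K -/K' -/L -/L'.
have kE : invfact k = (k + 1)%:~R * K by apply: (down (k + 1)); lia.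
have k1E : invfact (k - 1) = k%:~R * invfact k by apply: (down k); lia.
have k2E : invfact (k - 2) = (k - 1)%:~R * invfact (k - 1)
  by apply: (down (k - 1)); lia.
have lE : invfact (l - 1) = l%:~R * L by apply: (down l); lia.
have l2E : invfact (l - 2) = (l - 1)%:~R * invfact (l - 1)
  by apply: (down (l - 1)); lia.
have k2'E : invfact (n%:Z - (k - 2)) = K' by congr invfact; lia.
have k1'E : invfact (n%:Z - (k - 1)) = (n%:Z - k + 2)%:~R * K'
  by apply: (down (n%:Z - k + 2)); lia.
have k'E : invfact (n%:Z - k) = (n%:Z - (k - 1))%:~R * invfact (n%:Z - (k - 1))
  by apply: (down (n%:Z - (k - 1))); lia.
have k_1'E : invfact (n%:Z - (k - -1)) = (n%:Z - k)%:~R * invfact (n%:Z - k)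
  by apply: (down (n%:Z - k)); lia.
have l2'E : invfact (n%:Z - (l - 2)) = L' by congr invfact; lia.
have l1'E : invfact (n%:Z - (l - 1)) = (n%:Z - l + 2)%:~R * L'
  by apply: (down (n%:Z - l + 2)); lia.
have l'E : invfact (n%:Z - l) = (n%:Z - (l - 1))%:~R * invfact (n%:Z - (l - 1))
  by apply: (down (n%:Z - (l - 1))); lia.
have k_1E : invfact (k - -1) = K by congr invfact; lia.
rewrite !subr0 k_1'E k'E k1'E k2'E k2E k1E kE l'E l1'E l2'E l2E lE -/K -/L.
rewrite 2!factS !natrM -(natr1 n.+1) -(natr1 n).
rewrite !(intrD, intrN, intrM).
exact: kernel_identity.
Qed.

(** * The rational series *)

Section FpsConst.
Variable A : comNzRingType.

Lemma fps_const_mulE (a : A) (f : fps A) n : (fps_const a * f) n = a * f n.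
Proof.
rewrite -[LHS]/(\sum_(i < n.+1) fps_const a i * f (n - i)%N).
by rewrite big_ord_recl subn0 big1 ?addr0// => i _; rewrite /fps_const /= mul0r.
Qed.

Lemma fps_t_mulE (f : fps A) n :
  (fps_t A * f) n = if n is m.+1 then f m else 0.
Proof.
rewrite -[LHS]/(\sum_(i < n.+1) fps_t A i * f (n - i)%N).
case: n => [|n]; first by rewrite big_ord1 /fps_t /= mul0r.
rewrite 2!big_ord_recl big1 => [|i _]; last by rewrite /fps_t /= mul0r.
by rewrite /fps_t /= mul0r mul1r add0r addr0 subSS subn0.
Qed.

Fact fps_const_is_zmod_morphism : zmod_morphism (@fps_const A).
Proof.
by move=> a b; apply/funext => -[|n]; rewrite -[RHS]/(_ - _) /fps_const /= ?subr0.
Qed.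

Fact fps_const_is_monoid_morphism : monoid_morphism (@fps_const A).
Proof.
split=> // a b; apply/funext => n; rewrite fps_const_mulE /fps_const.
by case: (n == 0)%N; rewrite ?mulr0.
Qed.

HB.instance Definition _ := GRing.isZmodMorphism.Build A (fps A) (@fps_const A)
  fps_const_is_zmod_morphism.
HB.instance Definition _ := GRing.isMonoidMorphism.Build A (fps A) (@fps_const A)
  fps_const_is_monoid_morphism.

Lemma fps_geometric (a : A) :
  (1 - fps_t A * fps_const a) * (fun n => a ^+ n : A) = 1.
Proof.
apply/funext => n; rewrite mulrBl mul1r -mulrA.
rewrite -[LHS]/(a ^+ n - (fps_t A * (fps_const a * (fun n => a ^+ n : A))) n).
rewrite fps_t_mulE; case: n => [|n]; first by rewrite subr0.
by rewrite fps_const_mulE -exprS subrr.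
Qed.

End FpsConst.

(** The denominator is the unit x^5 y^4 times 1 - tS, whose inverse is the
    geometric series. *)
Lemma kernel_coef_gf :
  let x  : fps (laurent rat) := fps_const (lmon 1 (1, 0)) in
  let y  : fps (laurent rat) := fps_const (lmon 1 (0, 1)) in
  let xb : fps (laurent rat) := fps_const (lmon 1 (-1, 0)) in
  let yb : fps (laurent rat) := fps_const (lmon 1 (0, -1)) in
  let t  : fps (laurent rat) := fps_t _ in
  (x ^+ 3 - 2 * y ^+ 2 - x) * (y ^+ 2 - x)
    * (x ^+ 2 * y ^+ 2 - y ^+ 2 - 2 * x)
  / (x ^+ 5 * y ^+ 4 * (1 - t * (y + x * yb + xb * yb + xb ^+ 2 * y)))
  = kernel_coef.
Proof.
move=> x y xb yb t.
have -> : y + x * yb + xb * yb + xb ^+ 2 * y = fps_const step_gf.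
  rewrite -!rmorphM -rmorphXn -rmorphM -!rmorphD /=; congr fps_const.
  by rewrite expr2 !lmonM !mulr1.
have -> : (x ^+ 3 - 2 * y ^+ 2 - x) * (y ^+ 2 - x)
    * (x ^+ 2 * y ^+ 2 - y ^+ 2 - 2 * x) = fps_const numerator.
  by rewrite !(rmorphM, rmorphB, rmorphXn, rmorph_nat).
pose g : fps (laurent rat) := fun n => step_gf ^+ n.
rewrite (@mulr1_eq _ _ (fps_const (lmon 1 (-5, -4)) * g)).
  by apply/funext => n; rewrite !fps_const_mulE mulrA.
rewrite mulrACA fps_geometric mulr1 -!rmorphXn -!rmorphM /=.
by rewrite lmon_xy lmonM mulr1.
Qed.

(** * Quadrant walks *)

Section WalkCount.
Variable S : {fset step}.

Definition walks_to (n : nat) (k : step) : nat :=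
  #|[set w : n.-tuple S | stays_in_quadrant w & position w == k]|.

Lemma walks_to0 k : walks_to 0 k = (k == 0).
Proof.
rewrite /walks_to; case: eqP => [->|k0].
  rewrite (_ : [set w | _] = [set: _]%SET) ?cardsT ?card_tuple//.
  apply/setP => w; rewrite !inE tuple0 /position big_nil eqxx andbT.
  by apply/forallP => i; rewrite /position /= big_nil.
apply/eqP; rewrite cards_eq0; apply/eqP/setP => w; rewrite !inE tuple0.
by rewrite /position big_nil [0 == k]eq_sym; apply/negbTE/nandP; right; apply/eqP.
Qed.

Lemma position_rcons (w : seq S) s : position (rcons w s) = position w + val s.
Proof. by rewrite /position -cats1 big_cat big_seq1. Qed.

Lemma stays_in_quadrant_rcons n (w : n.-tuple S) s :
  stays_in_quadrant (rcons_tuple w s) =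
  stays_in_quadrant w && in_quadrant (position w + val s).
Proof.
apply/forallP/andP => [st|[/forallP st ink] /= k].
  split; last by have := st ord_max; rewrite take_oversize ?size_tuple// position_rcons.
  apply/forallP => k; have := st (widen_ord (leqnSn _) k).
  by rewrite /= -cats1 takel_cat// size_tuple -ltnS.
have [kn|kn] := ltnP k n.+1.
  by rewrite -cats1 takel_cat ?size_tuple//; exact: (st (Ordinal kn)).
by rewrite take_oversize ?position_rcons// size_rcons size_tuple.
Qed.

(** Decomposition at the last step: the recursion shared with the coefficients
    of the rational series. *)
Lemma walks_toS n k :
  walks_to n.+1 k =
  if in_quadrant k then (\sum_(s : S) walks_to n (k - val s)%R)%N else 0%N.
Proof.
transitivity (\sum_(s : S) #|[set w : n.-tuple S |
   stays_in_quadrant (rcons_tuple w s) & position (rcons w s) == k]|)%N.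
  rewrite /walks_to -sum1dep_card.
  under [RHS]eq_bigr do rewrite -sum1dep_card.
  rewrite pair_big_dep /=.
  pose h (p : S * n.-tuple S) := rcons_tuple p.2 p.1.
  rewrite (reindex h)//=; apply: onW_bij; apply: inj_card_bij.
    by move=> [s w] [s' w'] /(congr1 val)/= /rcons_inj[/val_inj -> ->].
  by rewrite card_prod !card_tuple expnS.
case: ifPn => ink.
  apply: eq_bigr => s _; apply: eq_card => w; rewrite !inE.
  rewrite stays_in_quadrant_rcons position_rcons.
  have -> : (position w == k - val s) = (position w + val s == k).
    by rewrite eq_sym subr_eq eq_sym.
  by case: eqP => [->|]; rewrite ?ink ?andbT// !andbF.
rewrite big1// => s _; apply/eqP; rewrite cards_eq0; apply/eqP/setP => w.
rewrite !inE stays_in_quadrant_rcons position_rcons.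
by apply/negbTE/andP => -[/andP[_ h] /eqP wk]; rewrite wk (negPf ink) in h.
Qed.
End WalkCount.

Definition steps : {fset step} := [fset (0, 1); (1, -1); (-1, -1); (-2, 1)]%fset.

Lemma sum_steps (V : nmodType) (F : step -> V) :
  \sum_(s : steps) F (val s) = F (0, 1) + F (1, -1) + F (-1, -1) + F (-2, 1).
Proof.
rewrite -(big_seq_fsetE _ _ predT F) /=.
rewrite (perm_big [:: (0, 1); (1, -1); (-1, -1); (-2, 1)]); last first.
  by apply: uniq_perm => [||s]; rewrite ?fset_uniq ?inE /= -?orbA.
by rewrite !big_cons big_nil /= addr0 !addrA.
Qed.

Lemma walks_to_out (S : {fset step}) n k : ~~ in_quadrant k -> walks_to S n k = 0%N.
Proof.
case: n => [|n] kq; last by rewrite walks_toS (negPf kq).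
by rewrite walks_to0; case: eqP kq => // ->.
Qed.

Lemma kernel_coef_out n (i j : int) :
  (forall k l : int, i = k - 2 * l -> j = n%:Z - 2 * k -> False) ->
  lcoef (kernel_coef n) (i, j) = 0.
Proof.
move=> out; rewrite /kernel_coef numeratorE !(mulrDl, mulNr) !(lcoefD, lcoefN).
have E (a b : int) c p q : p = a - 2 * b -> q = - (2 * a) ->
    lcoef (lmon c (p, q) * step_gf ^+ n) (i, j) = 0.
  move=> pE qE; rewrite lcoef_lmonM; rewrite lcoef_step_gfX_out ?mulr0//.
  by move=> k l /= ik jk; apply: (out (k + a) (l + b)); lia.
by rewrite (E 0 0)// (E 1 0)// (E 0 2)// (E 1 2)// (E (-1) 1)// (E (-1) 2)//
  (E 2 1)// (E 2 2)// !oppr0 !addr0.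
Qed.

(** One of the factors i + 1 and j + 1 of the closed form is zero. *)
Lemma kernel_coef_boundary n (i j : int) : i = -1 \/ j = -1 ->
  lcoef (kernel_coef n) (i, j) = 0.
Proof.
move=> ij; have [[k [l [ik jk]]]|out] :=
    pselect (exists k l : int, i = k - 2 * l /\ j = n%:Z - 2 * k); last first.
  by apply: kernel_coef_out => k l ik jk; apply: out; exists k, l.
rewrite ik jk kernel_coefE /closed_form.
have [->|->] : k - 2 * l + 1 = 0 \/ n%:Z - 2 * k + 1 = 0 by lia.
  by rewrite !mul0r.
by rewrite mulr0 !mul0r.
Qed.

Lemma kernel_coefS n : kernel_coef n.+1 = step_gf * kernel_coef n.
Proof. by rewrite /kernel_coef exprS mulrCA. Qed.

Lemma kernel_coef0 k : in_quadrant k -> lcoef (kernel_coef 0) k = (k == 0)%:R.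
Proof.
case: k => i j /andP[/= i0 j0].
rewrite /kernel_coef numeratorE expr0 mulr1 !(lcoefD, lcoefN) !lcoef_mon.
have E (p q : int) : (p < 0) || (q < 0) -> ((i, j) == (p, q)) = false.
  by move=> pq; apply/eqP => -[ip jq]; lia.
rewrite (E 1 (-2))// (E (-4) 0)// (E (-3) (-2))// (E (-3) 2)// (E (-5) 2)//.
rewrite (E 0 (-4))// (E (-2) (-4))// oppr0 !addr0.
by case: ((i, j) == _).
Qed.

(** No step increases a coordinate by more than one, so the predecessors of a
    point of the quadrant have coordinates at least -1: those outside the
    quadrant lie on the two lines where the kernel coefficients vanish. *)
Lemma walks_to_kernel n k : in_quadrant k ->
  (walks_to steps n k)%:R = lcoef (kernel_coef n) k.
Proof.
elim: n k => [|n IHn] k kq; first by rewrite walks_to0 kernel_coef0.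
have IH i j : -1 <= i -> -1 <= j ->
    (walks_to steps n (i, j))%:R = lcoef (kernel_coef n) (i, j).
  move=> i1 j1; have [ijq|ijq] := boolP (in_quadrant (i, j)); first exact: IHn.
  rewrite walks_to_out// kernel_coef_boundary//.
  by move: ijq; rewrite /in_quadrant /=; lia.
rewrite walks_toS kq kernel_coefS; case: k kq => i j /andP[/= i0 j0].
rewrite lcoef_step_gfM -!IH; [|lia..].
rewrite (sum_steps (fun s => walks_to steps n ((i, j) - s))) -!natrD.
congr (_%:R); rewrite -![RHS]/(_ + _ : nat).
have E s (a b : int) : s = (i, j) - (a, b) ->
    walks_to steps n ((i, j) - (a, b)) = walks_to steps n s by move=> ->.
rewrite (E (i, j - 1) 0 1) ?(E (i - 1, j + 1) 1 (-1)).
rewrite ?(E (i + 1, j + 1) (-1) (-1)) ?(E (i + 2, j - 1) (-2) 1)//.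
all: by congr pair => /=; lia.
Qed.

Lemma quadrant_walks_eq0 (i j n : nat) :
  (forall m : nat, n <> 2 * i + j + 4 * m)%N -> quadrant_walks steps i j n = 0%N.
Proof.
move=> out; apply/eqP; rewrite -(eqr_nat rat); apply/eqP.
rewrite -[quadrant_walks _ _ _ _]/(walks_to steps n (i%:Z, j%:Z)).
rewrite walks_to_kernel//.
have [[k [l [ik jk]]]|outZ] := pselect (exists k l : int,
    i%:Z = k - 2 * l /\ j%:Z = n%:Z - 2 * k); last first.
  by apply: kernel_coef_out => k l ik jk; apply: outZ; exists k, l.
rewrite ik jk kernel_coefE /closed_form; case: l ik => [l|l] ik.
  by case: (out l); lia.
by rewrite /= mulr0 !mul0r.
Qed.

Lemma quadrant_walks_closed (i j n m : nat) :
  (n = 2 * i + j + 4 * m)%N ->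
  (quadrant_walks steps i j n)%:R =
    ((i + 1) * (j + 1) * (i + j + 2) * n`! * (n + 2)`!)%N%:R
    / (m`! * (3 * m + 2 * i + j + 2)`! * (2 * m + i + 1)`!
         * (2 * m + i + j + 2)`!)%N%:R :> rat.
Proof.
move=> nE; rewrite -[quadrant_walks _ _ _ _]/(walks_to steps n (i%:Z, j%:Z)).
rewrite walks_to_kernel//.
have -> : (i%:Z, j%:Z) = ((i + 2 * m)%:Z - 2 * m%:Z, n%:Z - 2 * (i + 2 * m)%:Z).
  by congr pair; lia.
rewrite kernel_coefE /closed_form.
have -> : (i + 2 * m)%:Z - 2 * m%:Z + 1 = (i + 1)%N by lia.
have -> : n%:Z - 2 * (i + 2 * m)%:Z + 1 = (j + 1)%N by lia.
have -> : n%:Z - (i + 2 * m)%:Z - 2 * m%:Z + 2 = (i + j + 2)%N by lia.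
have -> : n%:Z - m%:Z + 2 = (3 * m + 2 * i + j + 2)%N by lia.
have -> : (i + 2 * m)%:Z + 1 = (2 * m + i + 1)%N by lia.
have -> : n%:Z - (i + 2 * m)%:Z + 2 = (2 * m + i + j + 2)%N by lia.
rewrite (addn2 n) /invfact !natrM !invfM !mulrA.
by [].
Qed.

Lemma walks_support (i j n : nat) : quadrant_walks steps i j n != 0%N ->
  exists m, (n = 2 * i + j + 4 * m)%N.
Proof.
move=> q0; apply: contrapT => nm; move/eqP: q0; apply.
by apply: quadrant_walks_eq0 => m nE; apply: nm; exists m.
Qed.

(** No walk of length n ends outside this range, so the finitely supported sums
    over all endpoints become sums over a list. *)
Definition box (n : nat) : seq (nat * nat) :=
  [seq (i, j) | i <- index_iota 0 n.+1, j <- index_iota 0 n.+1].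

Lemma mem_box n i j : ((i, j) \in box n) = (i <= n)%N && (j <= n)%N.
Proof.
apply/allpairsP/andP => [[[i' j'] [/= i'n j'n [-> ->]]]|[iln jln]].
  by move: i'n j'n; rewrite !mem_index_iota.
by exists (i, j); rewrite !mem_index_iota.
Qed.

Lemma box_uniq n : uniq (box n).
Proof. by apply: allpairs_uniq; rewrite ?iota_uniq// => -[? ?] [? ?]. Qed.

Lemma walks_out_box n ij : ij \notin box n ->
  quadrant_walks steps ij.1 ij.2 n = 0%N.
Proof.
case: ij => i j; rewrite mem_box => ijn; apply/eqP; apply: contraNT ijn.
by move=> /walks_support[m /= mE]; lia.
Qed.

Lemma fsbig_box (T : Type) (idx : T) (op : Monoid.com_law idx) n (F : nat * nat -> T) :
  (forall ij, quadrant_walks steps ij.1 ij.2 n = 0%N -> F ij = idx) ->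
  \big[op/idx]_(ij \in [set: nat * nat]) F ij = \big[op/idx]_(ij <- box n) F ij.
Proof.
move=> F0; rewrite (fsbigE (box n)) ?box_uniq//; last first.
  by move=> ij _ /walks_out_box/F0.
by apply: eq_bigl => ij; rewrite in_setT.
Qed.

Lemma walk_gfE : walk_gf steps = nonneg_part kernel_coef.
Proof.
apply/funext => n; apply/laurentP => -[i j].
rewrite /walk_gf (@fsbig_box _ _ _ n); last first.
  move=> ij ->.
  by apply/laurentP => k; rewrite lcoef_mon lcoef0; case: ifP.
rewrite lcoef_sum /nonneg_part lcoef_mk.
under eq_bigr do rewrite lcoef_mon.
transitivity (if in_quadrant (i, j) then lcoef (kernel_coef n) (i, j) else 0); last first.
  by have [ks|/lcoef_out ->] := boolP ((i, j) \in lsupp (kernel_coef n)); rewrite ?if_same.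
case: ifPn => ijq; last first.
  by rewrite big1// => -[a b] _ /=; case: eqP ijq => // -[-> ->].
case: i j ijq => [i|//] [j|//] _; rewrite -walks_to_kernel//.
have [ijn|ijn] := boolP ((i, j) \in box n).
  rewrite (bigD1_seq (i, j)) ?box_uniq//= eqxx big1 ?addr0// => -[a b] abn.
  by case: eqP => // -[ia jb]; rewrite ia jb eqxx in abn.
rewrite big_seq big1 => [|[a b] abn]; last first.
  case: eqP => // -[ia jb]; by rewrite ia jb abn in ijn.
by have := @walks_out_box n (i, j) ijn; rewrite /quadrant_walks /walks_to => ->.
Qed.

(** * Domination of the walk numbers *)

(** C(N, m+1) / C(N, m) = (N - m) / (m + 1) is at least 3 below a quarter. *)
Lemma bin_quarter_step (N m : nat) : (4 * m + 3 <= N)%N ->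
  (3 * 'C(N, m) <= 'C(N, m.+1))%N.
Proof.
move=> mN; rewrite -(leq_pmul2l (ltn0Sn m)) mul_bin_left mulnA leq_mul2r.
by apply/orP; right; lia.
Qed.

Lemma bin_quarter_decay (N M d : nat) : (d <= M)%N -> (4 * M <= N)%N ->
  (3 ^ d * 'C(N, M - d) <= 'C(N, M))%N.
Proof.
move=> dM MN; elim: d dM => [|d IHd] dM; first by rewrite mul1n subn0.
apply: leq_trans (IHd (ltnW dM)); rewrite expnSr -mulnA leq_mul2l.
apply/orP; right; have -> : (M - d = (M - d.+1).+1)%N by lia.
by apply: bin_quarter_step; lia.
Qed.

Lemma bin_quarter_shift (M a : nat) : ('C(4 * M + a, M) <= 2 ^ a * 'C(4 * M, M))%N.
Proof.
case: M => [|M]; first by rewrite !bin0 muln1 expn_gt0.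
elim: a => [|a IHa]; first by rewrite addn0 mul1n.
rewrite addnS binS expnS -mulnA mul2n -addnn leq_add//.
apply: leq_trans IHa; apply: leq_trans (bin_quarter_step _); last by lia.
by rewrite leq_pmull.
Qed.

Lemma bin_le_central (p k : nat) : ('C(2 * p, k) <= 'C(2 * p, p))%N.
Proof.
have low m : (m <= p)%N -> ('C(2 * p, p - m) <= 'C(2 * p, p))%N.
  elim: m => [|m IHm] mp; first by rewrite subn0.
  apply: leq_trans (IHm (ltnW mp)); have -> : (p - m = (p - m.+1).+1)%N by lia.
  rewrite -(leq_pmul2l (ltn0Sn (p - m.+1))) mul_bin_left leq_mul2r.
  by apply/orP; right; lia.
have [kp|pk] := leqP k p; first by rewrite -(subKn kp) low ?leq_subr.
have [kp2|kp2] := leqP k (2 * p); last by rewrite bin_small.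
rewrite -bin_sub//.
have -> : (2 * p - k = p - (k - p))%N by lia.
by apply: low; lia.
Qed.

Lemma bin_central_shift (p a k : nat) : ('C(2 * p + a, k) <= 2 ^ a * 'C(2 * p, p))%N.
Proof.
elim: a k => [|a IHa] k; first by rewrite addn0 mul1n bin_le_central.
case: k => [|k]; first by rewrite bin0 muln_gt0 expn_gt0 bin_gt0; lia.
by rewrite addnS binS expnS -mulnA [X in (_ <= X)%N]mul2n -addnn leq_add ?IHa.
Qed.

Lemma natr_fact_neq0 (K : numFieldType) n : (n`!%:R : K) != 0.
Proof. by rewrite pnatr_eq0 -lt0n fact_gt0. Qed.

Lemma natr_bin (K : numFieldType) (N k k' : nat) : (N = k + k')%N ->
  ('C(N, k)%:R : K) = N`!%:R / (k`!%:R * k'`!%:R).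
Proof.
move=> ->; rewrite -(@bin_fact (k + k') k) ?leq_addr// addKn !natrM.
by field; rewrite !natr_fact_neq0.
Qed.

(** The scale against which all walk numbers of length near 4M are measured. *)
Definition main_bin (M : nat) : nat := ('C(4 * M, M) * 'C(4 * M, 2 * M))%N.

Lemma main_bin_gt0 M : (0 < main_bin M)%N.
Proof. by rewrite muln_gt0 !bin_gt0; lia. Qed.

Definition weight (i j : nat) : nat := ((i + 1) * (j + 1) * (i + j + 2))%N.

Lemma weight_gt0 i j : (0 < weight i j)%N.
Proof. by rewrite /weight !muln_gt0 !addn1 addn2. Qed.

(** The closed form as a product of two binomials, which separates the decay in
    m from the choice of i. *)
Lemma quadrant_walks_bin (i j m n : nat) : (n = 2 * i + j + 4 * m)%N ->
  (quadrant_walks steps i j n * ((n + 1) * (n + 2) * (n + 3)) =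
   weight i j * ('C(n + 2, m) * 'C(n + 3, 2 * m + i + 1)))%N.
Proof.
move=> nE; apply/eqP; rewrite -(eqr_nat rat) !natrM; apply/eqP.
rewrite (quadrant_walks_closed nE).
rewrite (@natr_bin _ _ m (3 * m + 2 * i + j + 2)); last by lia.
rewrite (@natr_bin _ _ (2 * m + i + 1) (2 * m + i + j + 2)); last by lia.
have -> : (n + 3)`!%:R = (n + 3)%:R * (n + 2)%:R * (n + 1)%:R * n`!%:R :> rat.
  by rewrite !addnS !addn0 !factS !natrM !mulrA.
rewrite /weight !natrM; field.
by rewrite !natr_fact_neq0.
Qed.

(** Off the line d = 0 the first binomial loses a factor 3 per unit of d; the
    second one is at most the central binomial.  Lowering their upper indices
    4M + r + 2 and 4M + r + 3 to 4M costs the powers of 2. *)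
Lemma quadrant_walks_le (r M d i j : nat) : (2 * i + j = r + 4 * d)%N ->
  (quadrant_walks steps i j (4 * M + r) * M ^ 3 * 3 ^ d <=
   weight i j * 2 ^ (2 * r + 5) * main_bin M)%N.
Proof.
move=> ijd; have [dM|Md] := leqP d M; last first.
  rewrite quadrant_walks_eq0 ?mul0n// => m; lia.
set n := (4 * M + r)%N.
have nE : (n = 2 * i + j + 4 * (M - d))%N by rewrite /n; lia.
have q3 : (quadrant_walks steps i j n * M ^ 3 <=
    weight i j * ('C(n + 2, M - d) * 'C(n + 3, 2 * (M - d) + i + 1)))%N.
  rewrite -(quadrant_walks_bin nE) leq_mul2l; apply/orP; right.
  rewrite !expnS expn0 muln1 mulnA.
  by apply: leq_mul; first apply: leq_mul; rewrite /n; lia.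
have h1 : (3 ^ d * 'C(n + 2, M - d) <= 2 ^ (r + 2) * 'C(4 * M, M))%N.
  apply: leq_trans (bin_quarter_decay dM _) _; first by rewrite /n; lia.
  by rewrite /n -addnA bin_quarter_shift.
have h2 : ('C(n + 3, 2 * (M - d) + i + 1) <= 2 ^ (r + 3) * 'C(4 * M, 2 * M))%N.
  have -> : (n + 3 = 2 * (2 * M) + (r + 3))%N by rewrite /n; lia.
  have -> : (4 * M = 2 * (2 * M))%N by lia.
  exact: bin_central_shift.
apply: leq_trans (leq_mul q3 (leqnn _)) _.
have := leq_mul h1 h2; rewrite /main_bin -(leq_pmul2l (weight_gt0 i j)).
set W := weight i j; set A := 'C(_, M - d); set B := 'C(_, _ + i + 1).
congr (_ <= _)%N; first by ring.
have -> : (2 * r + 5 = (r + 2) + (r + 3))%N by lia.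
by rewrite (expnD 2 (r + 2) (r + 3)); ring.
Qed.

(** The walks of length 4M + r that end on the line 2i + j = r + 4d, that is,
    those with m = M - d in the closed form. *)
Definition layer (r M d : nat) : nat :=
  (\sum_(0 <= i < (r + 4 * d).+1 | 2 * i <= r + 4 * d)
     quadrant_walks steps i (r + 4 * d - 2 * i) (4 * M + r))%N.

Lemma total_layers (r M : nat) : (r < 4)%N ->
  total_quadrant_walks steps (4 * M + r) = (\sum_(d < M.+1) layer r M d)%N.
Proof.
move=> r4; rewrite /total_quadrant_walks (@fsbig_box _ _ _ (4 * M + r))//.
set n := (4 * M + r)%N.
transitivity (\sum_(ij <- box n) \sum_(d < M.+1 | 2 * ij.1 + ij.2 == r + 4 * d)
    quadrant_walks steps ij.1 ij.2 n)%N.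
  apply: eq_bigr => -[i j] _ /=.
  have [q0|/walks_support[m mE]] := eqVneq (quadrant_walks steps i j n) 0%N.
    by rewrite q0 big1.
  have dM : (M - m < M.+1)%N by lia.
  rewrite (big_pred1 (Ordinal dM))// => d /=.
  by apply/eqP/eqP => [E|-> /=]; [apply/val_inj => /=|]; move: mE; rewrite /n; lia.
rewrite (exchange_big_dep xpredT)//=; apply: eq_bigr => d _.
rewrite big_mkcond big_allpairs_dep /=.
transitivity (\sum_(0 <= i < n.+1 | (2 * i <= r + 4 * d)%N)
    quadrant_walks steps i (r + 4 * d - 2 * i) n)%N.
  rewrite [RHS]big_mkcond /=; apply: eq_bigr => i _; rewrite -big_mkcond /=.
  case: ifP => id; last first.
    by rewrite big1// => j /eqP ij; lia.
  rewrite -big_filter (perm_big [:: (r + 4 * d - 2 * i)%N]) ?big_seq1//.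
  apply: uniq_perm; rewrite ?filter_uniq ?iota_uniq// => j.
  rewrite mem_filter mem_seq1 mem_index_iota /=.
  apply/andP/eqP => [[/eqP ij _]|->]; first by lia.
  by split; [apply/eqP|]; have := ltn_ord d; rewrite /n; lia.
rewrite /layer (@big_nat_widen _ _ _ 0 (r + 4 * d).+1 n.+1); last first.
  by have := ltn_ord d; rewrite /n; lia.
by apply: eq_bigl => i; apply/idP/andP => [|[]//]; split=> //; lia.
Qed.

(** There are at most 4(d + 1) endpoints, each of weight at most
    4(d + 1) * 4(d + 1) * 5(d + 1), and 2r + 5 is at most 11. *)
Lemma layer_le (r M d : nat) : (r < 4)%N ->
  (layer r M d * M ^ 3 * 3 ^ d <= 320 * 2 ^ 11 * d.+1 ^ 4 * main_bin M)%N.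
Proof.
move=> r4; rewrite /layer !big_distrl /=.
apply: (@leq_trans (\sum_(0 <= i < (r + 4 * d).+1) (80 * d.+1 ^ 3 * 2 ^ 11 * main_bin M))%N).
  rewrite big_mkcond; apply: leq_sum => i _; case: ifP => // id.
  apply: leq_trans (quadrant_walks_le _ _) _; first by lia.
  rewrite leq_mul2r; apply/orP; right.
  apply: leq_mul; last by rewrite leq_exp2l//; lia.
  have -> : (80 * d.+1 ^ 3 = (4 * d.+1) * (4 * d.+1) * (5 * d.+1))%N by rewrite !expnS; lia.
  by rewrite /weight; apply: leq_mul; first apply: leq_mul; lia.
rewrite sum_nat_const_nat subn0.
have : ((r + 4 * d).+1 <= 4 * d.+1)%N by lia.
move/(leq_mul (leqnn (80 * d.+1 ^ 3 * 2 ^ 11 * main_bin M)%N)).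
rewrite mulnC => /leq_trans; apply; apply/eq_leq; rewrite [(d.+1 ^ 4)%N]expnS; ring.
Qed.

Section Exponents.
Variable R : realType.
Local Open Scope classical_set_scope.

(** * Limits of real sequences *)

Lemma cvgn_cst (a : R) : (fun _ : nat => a) @ \oo --> a.
Proof. exact: cvg_cst. Qed.

Lemma cvgn_add (f g : nat -> R) (a b : R) : f @ \oo --> a -> g @ \oo --> b ->
  (fun n => f n + g n) @ \oo --> a + b.
Proof. exact: cvgD. Qed.

Lemma cvgn_mul (f g : nat -> R) (a b : R) : f @ \oo --> a -> g @ \oo --> b ->
  (fun n => f n * g n) @ \oo --> a * b.
Proof. exact: cvgM. Qed.

Lemma cvgn_div (f g : nat -> R) (a b : R) : b != 0 -> f @ \oo --> a ->
  g @ \oo --> b -> (fun n => f n / g n) @ \oo --> a / b.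
Proof. by move=> b0 fa gb; apply: cvgn_mul => //; exact: cvgV. Qed.

Lemma eq_cvgn (f g : nat -> R) (a : R) : (\forall n \near \oo, f n = g n) ->
  f @ \oo --> a -> g @ \oo --> a.
Proof. by move=> fg fa; apply: cvg_trans fa; apply: near_eq_cvg. Qed.

Lemma cvg_invn : (fun n => n%:R^-1 : R) @ \oo --> (0 : R).
Proof. by rewrite -cvg_shiftS; exact: cvg_harmonic. Qed.

Lemma cvg_linear_ratio (c a b : nat) : (0 < c)%N ->
  (fun M => (c * M + a - b)%N%:R / M%:R : R) @ \oo --> (c%:R : R).
Proof.
move=> c0.
have := cvgn_add (@cvgn_cst c%:R) (cvgn_mul (@cvgn_cst (a%:R - b%:R)) cvg_invn).
rewrite mulr0 addr0; apply: eq_cvgn; near=> M.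
have M0 : (0 < M)%N by near: M; exact: nbhs_infty_gt.
have Mb : (b <= M)%N by near: M; exact: nbhs_infty_ge.
have MR : (M%:R : R) != 0 by rewrite pnatr_eq0 -lt0n.
have bM : (b <= c * M + a)%N by nia.
by rewrite natrB// natrD natrM; field.
Unshelve. all: by end_near. Qed.

(** Shifting the argument of a factorial by a fixed amount e multiplies it by
    (cM)^e asymptotically; the amount a - b may be negative. *)
Lemma cvg_fact_ratio (c a b : nat) : (0 < c)%N ->
  (fun M => (c * M + a - b)`!%:R / (c * M)`!%:R * M%:R ^+ b / M%:R ^+ a : R)
    @ \oo --> (c%:R ^+ a / c%:R ^+ b : R).
Proof.
move=> c0; have cR : (c%:R : R) != 0 by rewrite pnatr_eq0 -lt0n.
elim: b => [|b IHb].
  elim: a => [|a IHa].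
    apply: (eq_cvgn _ (@cvgn_cst (c%:R ^+ 0 / c%:R ^+ 0))).
    by near=> M; rewrite addn0 subn0 !expr0 !divr1 mulr1 divff.
  have -> : c%:R ^+ a.+1 / c%:R ^+ 0 = c%:R ^+ a / c%:R ^+ 0 * c%:R :> R.
    by rewrite exprSr mulrAC.
  apply: (eq_cvgn _ (cvgn_mul IHa (@cvg_linear_ratio _ a.+1 0 c0))).
  near=> M; have M0 : (0 < M)%N by near: M; exact: nbhs_infty_gt.
  have MR : (M%:R : R) != 0 by rewrite pnatr_eq0 -lt0n.
  rewrite !subn0 addnS factS natrM exprS; field.
  by rewrite natr_fact_neq0 MR expf_neq0.
have -> : c%:R ^+ a / c%:R ^+ b.+1 = c%:R ^+ a / c%:R ^+ b / c%:R :> R.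
  by rewrite exprSr invfM mulrA.
apply: (eq_cvgn _ (cvgn_div cR IHb (@cvg_linear_ratio _ a b c0))); near=> M.
have M0 : (0 < M)%N by near: M; exact: nbhs_infty_gt.
have Mb : (b < M)%N by near: M; exact: nbhs_infty_gt.
have MR : (M%:R : R) != 0 by rewrite pnatr_eq0 -lt0n.
have E : (c * M + a - b = (c * M + a - b.+1).+1)%N by nia.
rewrite /= E factS natrM exprS invf_div; field.
by rewrite natr_fact_neq0 expf_neq0//= nat1r pnatr_eq0.
Unshelve. all: by end_near. Qed.

Lemma cvgn_sum (I : Type) (s : seq I) (P : pred I) (f : I -> nat -> R) (a : I -> R) :
  (forall i, P i -> f i @ \oo --> a i) ->
  (fun n => \sum_(i <- s | P i) f i n) @ \oo --> \sum_(i <- s | P i) a i.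
Proof.
move=> fa; elim: s => [|i s IHs].
  rewrite big_nil; under eq_fun do rewrite big_nil.
  exact: cvgn_cst.
rewrite big_cons; under eq_fun do rewrite big_cons.
by case: ifPn => // Pi; apply: cvgn_add IHs; exact: fa.
Qed.

(** Tannery's theorem, that is, dominated convergence for series, with a
    geometric majorant: the tails are uniformly small, and the remaining sum is
    finite. *)
Lemma tannery (f : nat -> nat -> R) (l : nat -> R) (C q : R) :
  0 <= C -> 0 <= q < 1 ->
  (forall M d, 0 <= f M d <= C * q ^+ d) ->
  (forall d, f ^~ d @ \oo --> (l d : R)) ->
  cvgn (series l) /\
  (fun M => \sum_(d < M.+1) f M d) @ \oo --> limn (series l).
Proof.
move=> C0 /andP[q0 q1] fC fl.
have l_bound d : 0 <= l d <= C * q ^+ d.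
  rewrite -(cvg_lim (@Rhausdorff _) (fl d)); apply/andP; split.
    by apply: limr_ge; [apply: cvgP; exact: fl | near=> M; case/andP: (fC M d)].
  by apply: limr_le; [apply: cvgP; exact: fl | near=> M; case/andP: (fC M d)].
have lc : cvgn (series l).
  apply: (@series_le_cvg _ l (geometric C q)) => [d|d|d|].
  - by case/andP: (l_bound d).
  - by rewrite /= mulr_ge0// exprn_ge0.
  - by case/andP: (l_bound d).
  by apply: is_cvg_geometric_series; rewrite ger0_norm.
split=> //.
have tail (g : nat -> R) D N : (forall d, 0 <= g d <= C * q ^+ d) -> (D <= N)%N ->
    `|\sum_(d < N) g d - \sum_(d < D) g d| <= C * q ^+ D / (1 - q).
  move=> gC DN; rewrite -!(big_mkord xpredT g) (big_cat_nat _ DN)//=.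
  rewrite addrAC subrr add0r ger0_norm; last first.
    by apply: sumr_ge0 => d _; case/andP: (gC d).
  rewrite ler_pdivlMr ?subr_gt0//.
  suff H : (\sum_(D <= d < N) g d) * (1 - q) <= C * (q ^+ D - q ^+ N).
    apply: le_trans H _; rewrite ler_wpM2l// lerBlDr lerDl exprn_ge0//.
  elim: N DN => [|N IHN].
    by rewrite leqn0 => /eqP ->; rewrite big_geq// mul0r subrr mulr0.
  rewrite leq_eqVlt ltnS => /predU1P[->|DN].
    by rewrite big_geq// mul0r subrr mulr0.
  rewrite big_nat_recr//= mulrDl.
  have -> : C * (q ^+ D - q ^+ N.+1) = C * (q ^+ D - q ^+ N) + C * q ^+ N * (1 - q).
    by rewrite exprS; ring.
  rewrite lerD ?IHN// ler_wpM2r//; first by rewrite subr_ge0 ltW.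
  by case/andP: (gC N).
apply/cvgrPdist_le => e e0.
have e3 : 0 < e / 3 by rewrite divr_gt0.
have [D [Dl Dt]] : exists D, `|limn (series l) - series l D| <= e / 3 /\
    C * q ^+ D / (1 - q) <= e / 3.
  have [D1 _ D1P] : \forall D \near \oo, `|limn (series l) - series l D| <= e / 3.
    by move/cvgrPdist_le : lc; exact.
  have [D2 _ D2P] : \forall D \near \oo, C * q ^+ D <= e / 3 * (1 - q).
    have q0' : `|q| < 1 by rewrite ger0_norm.
    have e3q : 0 < e / 3 * (1 - q) by rewrite mulr_gt0// subr_gt0.
    have := cvgr_le _ (@cvg_geometric R C q q0') _ e3q; exact.
  exists (maxn D1 D2); split; first by apply: D1P; exact: leq_maxl.
  rewrite ler_pdivrMr ?subr_gt0//; apply: D2P; exact: leq_maxr.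
have fin : (fun M => \sum_(d < D) f M d) @ \oo --> \sum_(d < D) l d.
  by apply: cvgn_sum.
near=> M.
have DM : (D <= M.+1)%N by apply: leqW; near: M; exact: nbhs_infty_ge.
have fD : `|\sum_(d < D) l d - \sum_(d < D) f M d| <= e / 3.
  by near: M; move/cvgrPdist_le : fin; exact.
have ft := tail (f M) D M.+1 (fC M) DM.
rewrite /series /= big_mkord in Dl.
move: Dl Dt fD ft.
set a := limn _; set b := \sum_(d < D) l d.
set c := \sum_(d < D) f M d; set g := \sum_(d < M.+1) _; set h := _ / (1 - q).
by rewrite !ler_norml; lra.
Unshelve. all: by end_near. Qed.

(** * Asymptotics of the walk numbers *)

Lemma main_bin_fact M : (main_bin M)%:R =
  (4 * M)`!%:R ^+ 2 / (M`!%:R * (3 * M)`!%:R * (2 * M)`!%:R ^+ 2) :> R.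
Proof.
rewrite /main_bin natrM (@natr_bin _ _ M (3 * M)) ?(@natr_bin _ _ (2 * M) (2 * M)); [|lia..].
by field; rewrite !natr_fact_neq0.
Qed.

Lemma main_binS M : let m : R := M%:R in
  (main_bin M.+1)%:R * (3 * (m + 1) ^+ 2 * (3 * m + 1) * (3 * m + 2)) =
  16 * (4 * m + 1) ^+ 2 * (4 * m + 3) ^+ 2 * (main_bin M)%:R.
Proof.
move=> m; rewrite !main_bin_fact.
have -> : (4 * M.+1 = (4 * M).+4)%N by lia.
have -> : (3 * M.+1 = (3 * M).+3)%N by lia.
have -> : (2 * M.+1 = (2 * M).+2)%N by lia.
rewrite !factS !natrM -!natr1 !natrM -/m.
have m0 : 0 <= m by rewrite ler0n.
field; rewrite !natr_fact_neq0 /=; repeat (apply/andP; split); lra.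
Qed.

(** The limit of main_bin (M + 1) / main_bin M. *)
Definition growth4 : R := 2 ^+ 12 / 3 ^+ 3.

(** The ratio of consecutive terms is rational by [main_binS]; it makes
    M b(M) / growth4^M nondecreasing, and (M + 1) b(M) / growth4^M nonincreasing
    from the value 1 at M = 0. *)
Lemma main_bin_asymptotics : exists2 w : R, 0 < w &
  (fun M => M%:R * (main_bin M)%:R / growth4 ^+ M) @ \oo --> w.
Proof.
pose u M : R := M%:R * (main_bin M)%:R / growth4 ^+ M.
pose v M : R := M.+1%:R * (main_bin M)%:R / growth4 ^+ M.
have g0 : 0 < growth4 by rewrite divr_gt0 ?exprn_gt0.
have b0 M : 0 < (main_bin M)%:R :> R by rewrite ltr0n main_bin_gt0.
have D0 M : 0 < 3 * (M%:R + 1) ^+ 2 * (3 * M%:R + 1) * (3 * M%:R + 2) :> R.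
  by have := ler0n R M => m0; rewrite !mulr_gt0 ?exprn_gt0//; lra.
have bS M : (main_bin M.+1)%:R =
   16 * (4 * M%:R + 1) ^+ 2 * (4 * M%:R + 3) ^+ 2 * (main_bin M)%:R /
   (3 * (M%:R + 1) ^+ 2 * (3 * M%:R + 1) * (3 * M%:R + 2)) :> R.
  by rewrite -main_binS mulfK// lt0r_neq0.
(* In both comparisons the difference is a positive factor times a polynomial
   in m with nonnegative coefficients. *)
have uS M : u M <= u M.+1.
  rewrite /u exprS invfM mulrA ler_pM2r ?invr_gt0 ?exprn_gt0//.
  rewrite ler_pdivlMr// bS -natr1 mulrA ler_pdivlMr; last exact: D0.
  rewrite -subr_ge0.
  set m : R := M%:R; set B : R := (main_bin M)%:R.
  rewrite [leRHS](_ : _ = B * (m + 1) * (16 / 9) * (352 * m ^+ 2 + 352 * m + 81)); last first.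
    by rewrite /growth4; field.
  have m0 : 0 <= m by rewrite ler0n.
  apply: mulr_ge0; first by rewrite !mulr_ge0 ?addr_ge0 ?(ltW (b0 M)).
  have : 0 <= m ^+ 2 by rewrite exprn_ge0.
  lra.
have vS M : v M.+1 <= v M.
  rewrite /v exprS invfM mulrA ler_pM2r ?invr_gt0 ?exprn_gt0//.
  rewrite ler_pdivrMr// bS -(natr1 M.+1) -(natr1 M) mulrA ler_pdivrMr; last exact: D0.
  rewrite -subr_ge0.
  set m : R := M%:R; set B : R := (main_bin M)%:R.
  rewrite [leRHS](_ : _ = B * (16 / 9) *
      (1952 * m ^+ 3 + 3552 * m ^+ 2 + 2031 * m + 350)); last first.
    by rewrite /growth4; field.
  have m0 : 0 <= m by rewrite ler0n.
  apply: mulr_ge0; first by rewrite mulr_ge0 ?(ltW (b0 M)).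
  have : 0 <= m ^+ 2 by rewrite exprn_ge0.
  have : 0 <= m ^+ 3 by rewrite exprn_ge0.
  lra.
have u_homo : {homo u : n m / (n <= m)%N >-> n <= m} by apply/nondecreasing_seqP.
have v1 M : v M <= 1.
  elim: M => [|M IHM]; last exact: le_trans (vS M) IHM.
  by rewrite /v /main_bin !muln0 !bin0 expr0 divr1 mulr1.
have uv M : u M <= v M.
  by rewrite /u /v ler_wpM2r ?invr_ge0 ?exprn_ge0 ?ltW// ltr_pM2r// ltr_nat.
have uc : cvgn u.
  apply: nondecreasing_is_cvgn => //; exists 1 => _ [M _ <-].
  exact: le_trans (uv M) (v1 M).
exists (limn u); last exact: uc.
apply: lt_le_trans (nondecreasing_cvgn_le u_homo uc 1%N).
by rewrite /u mul1r divr_gt0// exprn_gt0.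
Qed.

(** The contributions c^e of the six factorials (cM + e)! of a walk number, each
    in the form given by [cvg_fact_ratio]. *)
Definition term_lim (r d i : nat) : R :=
  (weight i (r + 4 * d - 2 * i))%:R
  * ((4%:R ^+ r / 4%:R ^+ 0) * (4%:R ^+ (r + 2) / 4%:R ^+ 0)
  / ((1%:R ^+ 0 / 1%:R ^+ d) * (3%:R ^+ (r + d + 2) / 3%:R ^+ 0)
     * (2%:R ^+ (i + 1) / 2%:R ^+ (2 * d)) * (2%:R ^+ (r + 2 * d + 2) / 2%:R ^+ i))).

Lemma term_lim_gt0 r d i : 0 < term_lim r d i.
Proof.
by rewrite /term_lim mulr_gt0 ?ltr0n ?weight_gt0//.
Qed.

Lemma quadrant_walks_factR (i j n m : nat) : (n = 2 * i + j + 4 * m)%N ->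
  (quadrant_walks steps i j n)%:R = (weight i j)%:R * (n`!%:R * (n + 2)`!%:R /
    (m`!%:R * (3 * m + 2 * i + j + 2)`!%:R * (2 * m + i + 1)`!%:R
     * (2 * m + i + j + 2)`!%:R)) :> R.
Proof.
move=> nE; have := congr1 (@ratr R) (quadrant_walks_closed nE).
rewrite fmorph_div !rmorph_nat /weight !natrM => ->.
by rewrite !mulrA.
Qed.

(** Each factorial is compared with (cM)! by [cvg_fact_ratio]; the powers of M
    add up to -3. *)
Lemma term_cvg (r d i j : nat) : (2 * i + j = r + 4 * d)%N ->
  (fun M => (quadrant_walks steps i j (4 * M + r))%:R * M%:R ^+ 3 / (main_bin M)%:R)
    @ \oo --> term_lim r d i.
Proof.
move=> ijd; have jE : (j = r + 4 * d - 2 * i)%N by lia.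
rewrite /term_lim -jE.
set W : R := (weight i j)%:R.
have fr c a b := @cvg_fact_ratio c a b.
have num := cvgn_mul (fr 4%N r 0 isT) (fr 4%N (r + 2)%N 0 isT).
have den := cvgn_mul (cvgn_mul (cvgn_mul (fr 1%N 0 d isT) (fr 3%N (r + d + 2)%N 0 isT))
   (fr 2%N (i + 1)%N (2 * d)%N isT)) (fr 2%N (r + 2 * d + 2)%N i isT).
have den0 : 1%:R ^+ 0 / 1%:R ^+ d * (3 ^+ (r + d + 2) / 3 ^+ 0) *
         (2 ^+ (i + 1) / 2 ^+ (2 * d)) *
         (2 ^+ (r + 2 * d + 2) / 2 ^+ i) != 0 :> R.
  by rewrite gt_eqF// !(divr_gt0, mulr_gt0)// ?exprn_gt0.
have := cvgn_mul (@cvgn_cst W) (cvgn_div den0 num den).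
apply: eq_cvgn; near=> M.
have M0 : (0 < M)%N by near: M; exact: nbhs_infty_gt.
have dM : (d <= M)%N by near: M; exact: nbhs_infty_ge.
have MR : (M%:R : R) != 0 by rewrite pnatr_eq0 -lt0n.
have nE : (4 * M + r = 2 * i + j + 4 * (M - d))%N by lia.
rewrite (quadrant_walks_factR nE) -/W main_bin_fact /=.
have -> : (3 * (M - d) + 2 * i + j + 2 = 3 * M + (r + d + 2))%N by lia.
have -> : (2 * (M - d) + i + 1 = 2 * M + (i + 1) - 2 * d)%N by lia.
have -> : (2 * (M - d) + i + j + 2 = 2 * M + (r + 2 * d + 2) - i)%N by lia.
rewrite !subn0 !mul1n !addn0 addnA.
have f0 := natr_fact_neq0 R; have p0 k : M%:R ^+ k != 0 :> R by rewrite expf_neq0.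
rewrite [(2 * d)%N]mul2n -[d.*2]addnn !exprD !expr0 !expr1.
move: (f0 (4 * M)%N) (f0 M) (f0 (3 * M)%N) (f0 (2 * M)%N) (f0 (M - d)%N)
  (f0 (3 * M + (r + d + 2))%N) (f0 (2 * M + (i + 1) - (d + d))%N)
  (f0 (2 * M + (r + (d + d) + 2) - i)%N) (p0 r) (p0 d) (p0 i).
move: (_ ^+ r) (_ ^+ d) (_ ^+ i) => Mr Md Mi.
move: (_`!%:R) (_`!%:R) (_`!%:R) (_`!%:R) (_`!%:R) (_`!%:R) (_`!%:R) (_`!%:R).
move=> F1 F2 F3 F4 F5 F6 F7 F8 n1 n2 n3 n4 n5 n6 n7 n8 nr nd ni.
field.
by rewrite ?n1 ?n2 ?n3 ?n4 ?n5 ?n6 ?n7 ?n8 ?nr ?nd ?ni ?MR.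
Unshelve. all: by end_near. Qed.

Definition layer_lim (r d : nat) : R :=
  \sum_(0 <= i < (r + 4 * d).+1 | (2 * i <= r + 4 * d)%N) term_lim r d i.

Lemma layer_cvg (r d : nat) :
  (fun M => (layer r M d)%:R * M%:R ^+ 3 / (main_bin M)%:R) @ \oo --> layer_lim r d.
Proof.
rewrite /layer; under eq_fun do rewrite natr_sum !mulr_suml.
by apply: cvgn_sum => i id; apply: term_cvg; lia.
Qed.

Lemma layer_lim_ge0 r d : 0 <= layer_lim r d.
Proof. by apply: sumr_ge0 => i _; exact/ltW/term_lim_gt0. Qed.

Lemma layer_lim0_gt0 r : 0 < layer_lim r 0.
Proof.
rewrite /layer_lim big_ltn_cond//= muln0 ltr_wpDr ?term_lim_gt0//.
by apply: sumr_ge0 => i _; exact/ltW/term_lim_gt0.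
Qed.

(** As 4 (5/4)^d >= d + 4 by induction, (d + 1)^4 3^-d is at most 4^4 times the
    d-th power of (5/4)^4 / 3 < 1. *)
Lemma layer_bound (r M d : nat) : (r < 4)%N ->
  0 <= ((layer r M d)%:R * M%:R ^+ 3 / (main_bin M)%:R : R)
    <= (320 * 2 ^+ 11 * 4 ^+ 4 : R) * ((5 / 4) ^+ 4 / 3) ^+ d.
Proof.
move=> r4; have b0 : 0 < (main_bin M)%:R :> R by rewrite ltr0n main_bin_gt0.
rewrite divr_ge0 ?mulr_ge0 ?exprn_ge0//=.
rewrite ler_pdivrMr// [(_ / 3) ^+ d]expr_div_n [leRHS]mulrAC [leRHS]mulrA.
rewrite ler_pdivlMr ?exprn_gt0//.
have h : (layer r M d)%:R * M%:R ^+ 3 * 3 ^+ d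
    <= 320 * 2 ^+ 11 * d.+1%:R ^+ 4 * (main_bin M)%:R :> R.
  by rewrite -!natrX -!natrM ler_nat layer_le.
apply: le_trans h _; rewrite [leRHS]mulrAC ler_wpM2r ?(ltW b0)// -[leRHS]mulrA.
apply: ler_wpM2l; first by rewrite mulr_ge0 ?exprn_ge0.
rewrite exprAC -exprMn lerXn2r ?nnegrE ?mulr_ge0 ?exprn_ge0 ?divr_ge0//.
suff : d%:R + 4 <= 4 * (5 / 4) ^+ d :> R by rewrite -natr1; lra.
elim: d => [|d IHd]; first by rewrite expr0; lra.
by rewrite -natr1 exprSr; have := ler0n R d; lra.
Qed.

Lemma total_cvg (r : nat) : (r < 4)%N -> exists2 K : R, 0 < K &
  (fun M => (total_quadrant_walks steps (4 * M + r))%:R * M%:R ^+ 3 / (main_bin M)%:R)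
    @ \oo --> K.
Proof.
move=> r4.
have [||lc fc] := @tannery _ (layer_lim r) _ _ _ _
  (fun M d => layer_bound M d r4) (fun d => @layer_cvg r d).
- by rewrite !mulr_ge0.
- lra.
exists (limn (series (layer_lim r))).
  have homo : {homo series (layer_lim r) : n m / (n <= m)%N >-> n <= m}.
    apply/nondecreasing_seqP => n.
    by rewrite /series /= big_nat_recr//= lerDl layer_lim_ge0.
  apply: lt_le_trans (nondecreasing_cvgn_le homo lc 1%N).
  by rewrite /series /= big_nat1 layer_lim0_gt0.
apply: eq_cvgn fc; near=> M.
by rewrite (total_layers _ r4) natr_sum !mulr_suml.
Unshelve. all: by end_near. Qed.

(** This number is the minimum of the step polynomial S(x, y) over positive x
    and y, reached at x = 3^(1/2), y = 3^(1/4). *)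
Definition growth : R := Num.sqrt (Num.sqrt growth4).

Lemma growth_gt0 : 0 < growth.
Proof. by rewrite !sqrtr_gt0 divr_gt0 ?exprn_gt0. Qed.

Lemma growthX4 : growth ^+ 4 = growth4.
Proof.
rewrite (exprM _ 2 2) !sqr_sqrtr ?sqrtr_ge0// divr_ge0 ?exprn_ge0//.
Qed.

(** From the scale main_bin M / M^3 to rho^n n^-4: the factor main_bin M costs
    growth4^M / M, and n/M tends to 4. *)
Lemma cvg_growth_scale (f : nat -> R) (r : nat) (K : R) : 0 < K ->
  (fun M => f M * M%:R ^+ 3 / (main_bin M)%:R) @ \oo --> K ->
  exists2 C : R, 0 < C &
  (fun M => f M * (4 * M + r)%:R ^+ 4 / growth ^+ (4 * M + r)) @ \oo --> C.
Proof.
move=> K0 fK; have [w w0 bw] := main_bin_asymptotics.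
have nM := @cvg_linear_ratio 4 r 0 isT.
have lim := cvgn_mul (cvgn_mul (cvgn_mul fK bw)
  (cvgn_mul (cvgn_mul nM nM) (cvgn_mul nM nM))) (@cvgn_cst (growth ^- r)).
eexists; last first.
  apply: eq_cvgn lim; near=> M.
  have M0 : (0 < M)%N by near: M; exact: nbhs_infty_gt.
  have MR : (M%:R : R) != 0 by rewrite pnatr_eq0 -lt0n.
  have bR : (main_bin M)%:R != 0 :> R by rewrite pnatr_eq0 -lt0n main_bin_gt0.
  rewrite subn0 [in RHS]exprD exprM growthX4 invfM.
  have gM : growth4 ^+ M != 0 by rewrite -growthX4 !expf_neq0// gt_eqF// growth_gt0.
  have gr : growth ^+ r != 0 by rewrite expf_neq0// gt_eqF// growth_gt0.
  move: (growth4 ^+ M) (growth ^+ r) gM gr => G4 G gM gr.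
  field.
  by rewrite ?MR ?bR ?gM ?gr.
by rewrite !mulr_gt0// ?invr_gt0 ?exprn_gt0 ?growth_gt0.
Unshelve. all: by end_near. Qed.

Lemma cvg_residues (f : nat -> R) (a : R) :
  (forall r, (r < 4)%N -> (fun M => f (4 * M + r)%N) @ \oo --> a) -> f @ \oo --> a.
Proof.
move=> fr; apply/cvgrPdist_le => e e0.
have N r : (r < 4)%N -> exists N, forall M, (N <= M)%N -> `|a - f (4 * M + r)%N| <= e.
  by move=> r4; have /cvgrPdist_le/(_ _ e0)[N _ NP] := fr r r4; exists N.
have [[[N0 H0] [N1 H1]] [[N2 H2] [N3 H3]]] :=
  ((N 0%N isT, N 1%N isT), (N 2%N isT, N 3%N isT)).
exists (4 * (N0 + N1 + N2 + N3))%N => // n /= nN.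
have := divn_eq n 4; rewrite mulnC.
have : (n %% 4 < 4)%N by rewrite ltn_mod.
have : (N0 + N1 + N2 + N3 <= n %/ 4)%N by rewrite leq_divRL// mulnC.
move: (n %/ 4)%N (n %% 4)%N => M r NM r4 ->.
by case: r r4 => [|[|[|[|//]]]] _; [apply: H0|apply: H1|apply: H2|apply: H3]; lia.
Qed.

(** * The two exponents *)

(** Each step changes 2i + j by 1 or -3, hence by 1 modulo 4. *)
Lemma position_residue (w : seq steps) :
  exists q : int, 2 * (position w).1 + (position w).2 = (size w)%:Z + 4 * q.
Proof.
elim/last_ind: w => [|w s [q qE]].
  by exists 0; rewrite /position big_nil.
rewrite position_rcons size_rcons /=.
have : val s \in steps by exact: valP.
rewrite !inE -!orbA => /or4P[] /eqP -> /=.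
- by exists q; lia.
- by exists q; lia.
- by exists (q - 1); lia.
- by exists (q - 1); lia.
Qed.

(** The walk (0, 1), (1, -1), (1, -1), (-2, 1) is closed, of length 4. *)
Lemma steps_period : is_period steps 4.
Proof.
move=> d; split=> [d4 n [w w0]|dn].
  apply: dvdn_trans d4 _.
  have [q] := position_residue w; rewrite w0 size_tuple /= => qE.
  by apply/dvdnP; exists `|q|%N; lia.
apply: dn.
have m1 : ((0, 1) : step) \in steps by rewrite !inE.
have m2 : ((1, -1) : step) \in steps by rewrite !inE.
have m3 : ((-2, 1) : step) \in steps by rewrite !inE.
exists [tuple FSetSub m1; FSetSub m2; FSetSub m2; FSetSub m3].
by rewrite /position !big_cons big_nil /=.
Qed.

Lemma powRN4 (n : nat) : n%:R `^ (-4) = n%:R ^- 4 :> R.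
Proof. exact: powR_invn. Qed.

Lemma steps_excursion_exponent : excursion_exponent steps (-4 : R).
Proof.
exists 4; split; first exact: steps_period.
have [C C0 Cl] := cvg_growth_scale 0 (term_lim_gt0 0 0 0) (@term_cvg 0 0 0 0 erefl).
have g0 := growth_gt0.
exists growth, (C / 2), (C * 2); split; rewrite ?divr_gt0 ?mulr_gt0//.
have C2 : 0 < C / 2 by rewrite divr_gt0.
have [N _ NP] := (cvgrPdist_le _ _).1 Cl _ C2.
exists (4 * N).+1 => // n /= nN /dvdnP[M nE].
have {}nE : n = (4 * M + 0)%N by lia.
have := NP M ltac:(by rewrite /=; lia); rewrite powRN4 /= -nE.
have n0 : 0 < n%:R ^+ 4 :> R by rewrite exprn_gt0// ltr0n; lia.
have gn : 0 < growth ^+ n by rewrite exprn_gt0.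
move: (growth ^+ n) (n%:R ^+ 4) (quadrant_walks _ _ _ _)%:R gn n0 => G T Q G0 T0.
rewrite ler_norml => /andP[lo hi]; apply/andP; split.
  rewrite ler_pdivrMr// -[leLHS]/(_ * _) -ler_pdivlMr//; lra.
rewrite ler_pdivlMr// -ler_pdivrMr//; lra.
Qed.

Lemma steps_walk_exponent : walk_exponent steps (-4 : R).
Proof.
have Cr r : exists C : R, (r < 4)%N -> 0 < C /\
    (fun M => (total_quadrant_walks steps (4 * M + r))%:R * (4 * M + r)%:R ^+ 4
      / growth ^+ (4 * M + r)) @ \oo --> C.
  have [r4|] := boolP (r < 4)%N; last by exists 0.
  have [K K0 Kl] := total_cvg r4.
  by have [C C0 Cl] := cvg_growth_scale r K0 Kl; exists C.
have [C CP] := choice Cr.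
have r4 n : (n %% 4 < 4)%N by rewrite ltn_mod.
exists growth, (fun n => C (n %% 4)%N); split.
- exact: growth_gt0.
- by move=> n; have [] := CP _ (r4 n).
- by exists 4%N => // n; rewrite modnDr.
apply: cvg_residues => r rlt.
have [C0 Cl] := CP r rlt.
have Cn0 : C r != 0 by rewrite gt_eqF.
have := cvgn_mul Cl (@cvgn_cst (C r)^-1); rewrite divff//.
apply: eq_cvgn; near=> M.
have rE : ((4 * M + r) %% 4 = r)%N by rewrite mulnC modnMDl modn_small.
by rewrite rE powRN4 !invfM invrK; ring.
Unshelve. all: by end_near. Qed.

End Exponents.

Theorem proposition24 (R : realType) :
  let S : {fset step} :=
    [fset (0, 1); (1, -1); (-1, -1); (-2, 1)]%fset in
  let x  : fps (laurent rat) := fps_const (lmon 1 (1, 0)) in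
  let y  : fps (laurent rat) := fps_const (lmon 1 (0, 1)) in
  let xb : fps (laurent rat) := fps_const (lmon 1 (-1, 0)) in
  let yb : fps (laurent rat) := fps_const (lmon 1 (0, -1)) in
  let t  : fps (laurent rat) := fps_t _ in
  [/\ walk_gf S =
        nonneg_part
          ((x ^+ 3 - 2 * y ^+ 2 - x) * (y ^+ 2 - x)
             * (x ^+ 2 * y ^+ 2 - y ^+ 2 - 2 * x)
           / (x ^+ 5 * y ^+ 4
                * (1 - t * (y + x * yb + xb * yb + xb ^+ 2 * y)))),
      forall i j n : nat,
        (forall m : nat, n <> 2 * i + j + 4 * m)%N ->
        quadrant_walks S i j n = 0%N,
      forall i j n m : nat,
        (n = 2 * i + j + 4 * m)%N ->
        (quadrant_walks S i j n)%:R =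
          ((i + 1) * (j + 1) * (i + j + 2) * n`! * (n + 2)`!)%N%:R
          / (m`! * (3 * m + 2 * i + j + 2)`! * (2 * m + i + 1)`!
               * (2 * m + i + j + 2)`!)%N%:R :> rat,
      excursion_exponent S (-4 : R)
    & walk_exponent S (-4 : R)].
Proof.
move=> S x y xb yb t; split.
- by rewrite kernel_coef_gf -walk_gfE.
- exact: quadrant_walks_eq0.
- exact: quadrant_walks_closed.
- exact: steps_excursion_exponent.
- exact: steps_walk_exponent.
Qed.
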